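(* Let $I,J$ be intervals in a poset $\mathcal{P}$ such that $I\cap J$ is an interval. Then there exists a nonzero morphism $f:C(I)\to C(J)$ if and only if $I\cap J$ is $(I,J)$-valid.
   Context: $\mathbb{K}$ is a fixed field. A subset $I$ of a poset $\mathcal{P}$ is poset-convex if $p,q\in I$, $r\in\mathcal{P}$, $p\le r\le q$ imply $r\in I$; it is poset-connected if for all $p,q\in I$ there are $r_1,\dots,r_{2n}\in I$ with $p\le r_1\ge r_2\le\cdots\le r_{2n-1}\ge r_{2n}\le q$. An interval is a poset-convex, poset-connected subset (possibly empty). A $\mathcal{P}$-module is a functor from $\mathcal{P}$ (viewed as a category with a unique morphism $p\to q$ iff $p\le q$) to $\mathbb{K}$-vector spaces; morphisms are natural transformations. For an interval $I$, $C(I)$ is the $\mathcal{P}$-module with $C(I)_p=\mathbb{K}$ if $p\in I$ and $0$ otherwise, and structure maps $\varphi_{C(I)}(p,q)=\mathrm{Id}_{\mathbb{K}}$ if $p,q\in I$ and $0$ otherwise (for $p\le q$). A connected component of $I\cap J$ is a nonempty poset-connected subset of $I\cap J$ that is maximal with respect to inclusion. A connected component $Q$ of $I\cap J$ is $(I,J)$-valid if for every $p\in Q$: (1) every $q\in I$ with $q\le p$ satisfies $q\in J$; and (2) every $r\in J$ with $r\ge p$ satisfies $r\in I$. In particular, when $I\cap J$ is an interval, ''$I\cap J$ is $(I,J)$-valid'' means that $I\cap J$ is nonempty (so that it is its own unique connected component) and conditions (1) and (2) hold for every $p\in I\cap J$. *)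

(* Defs.v *)
From HB Require Import structures.
From mathcomp Require Import all_boot all_order all_algebra.
From mathcomp Require Import boolp classical_sets.

Set Implicit Arguments.
Unset Strict Implicit.
Unset Printing Implicit Defensive.

Import Order.TTheory GRing.Theory.
Local Open Scope classical_set_scope.
Local Open Scope ring_scope.

Section PosetSets.
Context {d : Order.disp_t} {P : porderType d}.
Implicit Types A Q : set P.

Definition poset_convex A : Prop :=
  forall p q r : P, A p -> A q -> (p <= r)%O -> (r <= q)%O -> A r.

(* The fence p <= r_1 >= r_2 <= ... >= r_{2n} <= q is encoded by
   r : nat -> P with the conventions r_0 = p and r_{2n+1} = q; only the values
   r_0, ..., r_{2n+1} matter. *)
Definition poset_connected A : Prop :=
  forall p q : P, A p -> A q ->
  exists (n : nat) (r : nat -> P),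
    [/\ r 0%N = p, r n.*2.+1 = q,
        (forall i, (i <= n.*2.+1)%N -> A (r i)),
        (forall i, (i <= n)%N -> (r i.*2 <= r i.*2.+1)%O) &
        (forall i, (i < n)%N -> (r i.*2.+2 <= r i.*2.+1)%O)].

Definition is_poset_interval A : Prop := poset_convex A /\ poset_connected A.

Definition connected_component_of A Q : Prop :=
  [/\ Q !=set0, Q `<=` A, poset_connected Q &
      forall Q', Q `<=` Q' -> Q' `<=` A -> poset_connected Q' -> Q' = Q].

Definition valid (I J Q : set P) : Prop :=
  connected_component_of (I `&` J) Q /\
  forall p, Q p ->
    (forall q, I q -> (q <= p)%O -> J q) /\
    (forall r, J r -> (p <= r)%O -> I r).

End PosetSets.

Record poset_interval {d : Order.disp_t} (P : porderType d) := PosetInterval {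
  interval_set :> set P;
  interval_setP : is_poset_interval interval_set
}.

Record pmodule (K : fieldType) {d : Order.disp_t} (P : porderType d) :=
  PModule {
  pmod_space :> P -> lmodType K;
  pmod_map : forall p q : P, (p <= q)%O ->
    {linear pmod_space p -> pmod_space q};
  pmod_map_id : forall (p : P) (lepp : (p <= p)%O) (x : pmod_space p),
    pmod_map lepp x = x;
  pmod_map_comp : forall (p q r : P) (lepq : (p <= q)%O) (leqr : (q <= r)%O)
      (lepr : (p <= r)%O) (x : pmod_space p),
    pmod_map lepr x = pmod_map leqr (pmod_map lepq x)
}.

Record pmod_hom (K : fieldType) {d : Order.disp_t} (P : porderType d)
    (M N : pmodule K P) := PModHom {
  hom_map :> forall p : P, {linear M p -> N p};
  hom_natural : forall (p q : P) (lepq : (p <= q)%O) (x : M p),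
    hom_map q (pmod_map M lepq x) = pmod_map N lepq (hom_map p x)
}.

Definition zero_hom (K : fieldType) {d : Order.disp_t} (P : porderType d)
    (M N : pmodule K P) : pmod_hom M N.
Proof.
exists (fun p => \0 : {linear M p -> N p}).
by move=> p q lepq x; rewrite linear0.
Defined.

Lemma pmod_homP (K : fieldType) {d : Order.disp_t} (P : porderType d)
    (M N : pmodule K P) (f g : pmod_hom M N) :
  (forall (p : P) (x : M p), f p x = g p x) <-> f = g.
Proof.
split=> [|-> //]; case: f g => [f fnat] [g gnat] /= fg.
have eqfg : f = g.
  apply: functional_extensionality_dep => p.
  move: (f p) (g p) (fg p) => u v /funext uv.
  case: u uv => u [[um] [us]]; case: v => v [[vm] [vs]] /= uv.
  move: um us vm vs; rewrite uv => um us vm vs.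
  by rewrite (Prop_irrelevance um vm) (Prop_irrelevance us vs).
by move: fnat gnat; rewrite eqfg => fnat gnat;
  rewrite (Prop_irrelevance fnat gnat).
Qed.

Section IntervalModule.
Variables (K : fieldType) (d : Order.disp_t) (P : porderType d).

(* 'rV[K]_0 plays the role of the zero vector space. *)
Definition line_or_zero (b : bool) : lmodType K :=
  if b then (K^o : lmodType K) else ('rV[K]_0 : lmodType K).

Definition line_or_zero_map (b c : bool) :
    {linear line_or_zero b -> line_or_zero c} :=
  match b, c return {linear line_or_zero b -> line_or_zero c} with
  | true, true => idfun
  | _, _ => \0
  end.

Variable I : poset_interval P.

Definition imod_space (p : P) : lmodType K := line_or_zero (p \in (I : set P)).

Definition imod_map (p q : P) (lepq : (p <= q)%O) :
    {linear imod_space p -> imod_space q} :=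
  line_or_zero_map (p \in (I : set P)) (q \in (I : set P)).

Lemma imod_map_id (p : P) (lepp : (p <= p)%O) (x : imod_space p) :
  imod_map lepp x = x.
Proof.
rewrite /imod_map; move: x; rewrite /imod_space.
by case: (p \in _) => x //=; rewrite [x]thinmx0.
Qed.

Lemma imod_map_comp (p q r : P) (lepq : (p <= q)%O) (leqr : (q <= r)%O)
    (lepr : (p <= r)%O) (x : imod_space p) :
  imod_map lepr x = imod_map leqr (imod_map lepq x).
Proof.
have cvx : p \in (I : set P) -> r \in (I : set P) -> q \in (I : set P).
  move=> /set_mem Ip /set_mem Ir; apply/mem_set.
  by have [cvxI _] := interval_setP I; apply: cvxI Ip Ir lepq leqr.
rewrite /imod_map; move: x cvx; rewrite /imod_space.
case: (p \in _); case: (q \in _); case: (r \in _) => x cvx //=.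
by have := cvx isT isT.
Qed.

Definition interval_module : pmodule K P :=
  PModule imod_map_id imod_map_comp.

End IntervalModule.

(* Main.v *)
Require Import Defs.
From mathcomp Require Import all_boot all_order all_algebra.
From mathcomp Require Import boolp classical_sets.

Local Open Scope classical_set_scope.

(** For p <= q, the structure map of C(I) from p to q is onto as soon as
    [q \in I] forces [p \in I], and that of C(J) is injective as soon as
    [p \in J] forces [q \in J].  By naturality, vanishing of a morphism
    f : C(I) -> C(J) therefore travels upwards in the first case
    ([interval_hom_vanish_up]) and downwards in the second
    ([interval_hom_vanish_down]).  Both hold between comparable points of
    I `&` J, so along fences f vanishes at all points of I `&` J or at none;
    outside I `&` J it vanishes because its source or its target is zero.
    Hence a nonzero f vanishes nowhere on I `&` J.  A point q of I outside J
    below some p of I `&` J would carry vanishing up to p, and a point of J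
    outside I above p would carry it down to p: this is validity.

    Conversely, the family that is the identity on I `&` J and zero elsewhere
    ([overlap_hom]) is natural: its two composites from C(I)_p to C(J)_q differ
    only if p is in I, q is in J and exactly one of [q \in I], [p \in J] holds,
    and each of these two situations is excluded by one half of validity. *)

Import Order.TTheory GRing.Theory.
Local Open Scope ring_scope.

(** Each point of a fence is comparable to the next one, so a property that
    passes in both directions between comparable points of [A] propagates
    along the fence. *)
Lemma poset_connected_ind {d : Order.disp_t} {P : porderType d} (A : set P)
    (S : P -> Prop) :
  poset_connected A ->
  (forall p q, A p -> A q -> (p <= q)%O -> S p -> S q) ->
  (forall p q, A p -> A q -> (p <= q)%O -> S q -> S p) ->
  forall p q, A p -> A q -> S p -> S q.
Proof.
move=> connA up down p q Ap Aq Sp.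
have [n [r [r0 rn Ar le_up le_down]]] := connA p q Ap Aq.
have le_fence i : (i <= n)%N -> (i.*2 <= n.*2.+1)%N.
  by move=> le_in; rewrite leqW // leq_double.
have le_fenceS i : (i <= n)%N -> (i.*2.+1 <= n.*2.+1)%N.
  by move=> le_in; rewrite ltnS leq_double.
have S_even i : (i <= n)%N -> S (r i.*2).
  elim: i => [|i IHi] lt_in; first by rewrite r0.
  apply: (down _ (r i.*2.+1)); [exact/Ar/le_fence | exact/Ar/le_fenceS/ltnW | |].
    exact: le_down.
  apply: (up (r i.*2)); last exact/IHi/ltnW.
  - exact/Ar/le_fence/ltnW.
  - exact/Ar/le_fenceS/ltnW.
  - exact/le_up/ltnW.
rewrite -rn; apply: (up (r n.*2)); last exact: S_even.
- exact/Ar/le_fence.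
- exact/Ar.
- exact: le_up.
Qed.

Section LineOrZero.
Context {K : fieldType}.

Lemma line_or_zeroF {b : bool} (x : line_or_zero K b) : ~~ b -> x = 0.
Proof. by case: b x => //= x _; rewrite [x]thinmx0. Qed.

Lemma line_or_zero_map_surj {b c : bool} (y : line_or_zero K c) :
  (c -> b) -> exists x, line_or_zero_map K b c x = y.
Proof.
case: c y => y cb; last by exists 0; rewrite linear0 (line_or_zeroF y).
by case: b cb => [_|/(_ isT)//]; exists y.
Qed.

Lemma line_or_zero_map_inj {b c : bool} (x : line_or_zero K b) :
  (b -> c) -> line_or_zero_map K b c x = 0 -> x = 0.
Proof.
case: b x => x bc; last by move=> _; apply: line_or_zeroF.
by case: c bc => [_|/(_ isT)].
Qed.

(** Both composites vanish unless [b1] and [c2] hold, and then each one is the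
    identity or zero according to its middle boolean; this is the only
    pointwise content of the naturality of [overlap_map]. *)
Lemma line_or_zero_map_square (b1 b2 c1 c2 : bool) (x : line_or_zero K b1) :
  (b1 -> c2 -> b2 = c1) ->
  line_or_zero_map K b2 c2 (line_or_zero_map K b1 b2 x) =
  line_or_zero_map K c1 c2 (line_or_zero_map K b1 c1 x).
Proof.
by case: b1 x; case: b2; case: c1; case: c2 => //= x eqbc;
  have := eqbc isT isT.
Qed.

End LineOrZero.

Section IntervalHom.
Context {K : fieldType} {d : Order.disp_t} {P : porderType d}.
Context {I J : poset_interval P}.

Section Vanishing.
Variable f : pmod_hom (interval_module K I) (interval_module K J).

Definition vanishes_at (p : P) : Prop := forall x, f p x = 0.

Lemma vanishes_at_notin (p : P) : ~ (I `&` J) p -> vanishes_at p.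
Proof.
move=> nIJp x; have [/set_mem Ip|nIp] := boolP (p \in (I : set P)).
  by apply: line_or_zeroF; apply/negP => /set_mem Jp; apply: nIJp.
by rewrite (line_or_zeroF x nIp) linear0.
Qed.

(** Every element of C(I)_q is the image of one of C(I)_p, whose image under f
    is zero. *)
Lemma interval_hom_vanish_up (p q : P) :
  (p <= q)%O -> ((I : set P) q -> (I : set P) p) ->
  vanishes_at p -> vanishes_at q.
Proof.
move=> lepq qpI f0 y.
have qpIb : q \in (I : set P) -> p \in (I : set P).
  by move=> /set_mem /qpI /mem_set.
have [x <-] := line_or_zero_map_surj y qpIb.
by have /= := hom_natural f lepq x; rewrite f0 linear0.
Qed.

(** No nonzero element of C(J)_p dies in C(J)_q. *)
Lemma interval_hom_vanish_down (p q : P) :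
  (p <= q)%O -> ((J : set P) p -> (J : set P) q) ->
  vanishes_at q -> vanishes_at p.
Proof.
move=> lepq pqJ f0 x.
apply: (@line_or_zero_map_inj _ _ (q \in (J : set P))).
  by move=> /set_mem /pqJ /mem_set.
by have /= := hom_natural f lepq x; rewrite f0 => /esym.
Qed.

Lemma vanishes_at_connected :
  poset_connected (I `&` J) ->
  forall p q, (I `&` J) p -> (I `&` J) q -> vanishes_at p -> vanishes_at q.
Proof.
move=> connIJ; apply: poset_connected_ind connIJ _ _.
- by move=> p q [Ip _] _ lepq; apply: interval_hom_vanish_up.
- by move=> p q _ [_ Jq] lepq; apply: interval_hom_vanish_down.
Qed.

(** A point violating either conclusion lies outside I `&` J, hence f vanishes
    there, and the transport lemmas carry this vanishing to [p]. *)
Lemma valid_at_nonvanishing (p : P) :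
  (I `&` J) p -> ~ vanishes_at p ->
  (forall q, (I : set P) q -> (q <= p)%O -> (J : set P) q) /\
  (forall r, (J : set P) r -> (p <= r)%O -> (I : set P) r).
Proof.
move=> IJp nf0; split.
- move=> q Iq leqp; apply: contrapT => nJq; apply: nf0.
  apply: interval_hom_vanish_up leqp _ _ => //.
  by apply: vanishes_at_notin => -[].
- move=> r Jr lepr; apply: contrapT => nIr; apply: nf0.
  apply: interval_hom_vanish_down lepr _ _ => //.
  by apply: vanishes_at_notin => -[].
Qed.

End Vanishing.

Definition overlap_map (p : P) :
    {linear interval_module K I p -> interval_module K J p} :=
  line_or_zero_map K (p \in (I : set P)) (p \in (J : set P)).

Lemma overlap_map_natural (vIJ : valid I J (I `&` J)) (p q : P)
    (lepq : (p <= q)%O) (x : interval_module K I p) :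
  overlap_map q (pmod_map (interval_module K I) lepq x) =
  pmod_map (interval_module K J) lepq (overlap_map p x).
Proof.
case: vIJ => _ vIJ; apply: line_or_zero_map_square.
move=> /set_mem Ip /set_mem Jq; apply/idP/idP => /set_mem H; apply/mem_set.
- by have [below _] := vIJ q (conj H Jq); apply: below lepq.
- by have [_ above] := vIJ p (conj Ip H); apply: above lepq.
Qed.

Definition overlap_hom (vIJ : valid I J (I `&` J)) :
    pmod_hom (interval_module K I) (interval_module K J) :=
  PModHom (overlap_map_natural vIJ).

End IntervalHom.

Lemma connected_component_of_self {d : Order.disp_t} {P : porderType d}
    (A : set P) :
  A !=set0 -> poset_connected A -> connected_component_of A A.
Proof. by move=> A0 connA; split=> // Q' sAQ' sQ'A _; apply/seteqP. Qed.

Theorem corollary3p5 (K : fieldType) (d : Order.disp_t) (P : porderType d)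
    (I J : poset_interval P) (hIJ : is_poset_interval (I `&` J)) :
  (exists f : pmod_hom (interval_module K I) (interval_module K J),
     f <> zero_hom (interval_module K I) (interval_module K J)) <->
  valid I J (I `&` J).
Proof.
have [_ connIJ] := hIJ; split.
- move=> [f fN0].
  have [p0 nf0] : exists p, ~ vanishes_at f p.
    apply: contrapT => /forallNP f0; apply: fN0; apply/pmod_homP => p x.
    exact: (contrapT (f0 p)).
  have IJp0 : (I `&` J) p0.
    by apply: contrapT => nIJ; apply: nf0; apply: vanishes_at_notin.
  split; first by apply: connected_component_of_self => //; exists p0.
  move=> p IJp; apply: (valid_at_nonvanishing f) => // f0; apply: nf0.
  exact: vanishes_at_connected f0.
- move=> vIJ; have [[[p [Ip Jp]] _ _ _] _] := vIJ.
  exists (overlap_hom vIJ) => /pmod_homP f0.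
  have /= := f0 p; rewrite /overlap_map /= /imod_space (mem_set Ip) (mem_set Jp).
  by move=> /(_ 1) /= /eqP; rewrite oner_eq0.
Qed.
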